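(* For any $\lambda>0$, prior $u\in\Delta_d$, and reference point $\theta\in\Delta_d$, the Gibbs posterior $$\hat\theta_\lambda=\arg\min_{\theta\in\Delta_d}\Big(\mathbb{E}_{\beta\sim\theta}[\hat R(\beta)]+\lambda D_{\mathrm{KL}}(\theta,u)\Big)$$ satisfies $$\mathbb{E}_{\beta\sim\hat\theta_\lambda}[R(\beta)]-\mathbb{E}_{\beta\sim\theta}[R(\beta)]\le\frac1{2\lambda}\|\hat R-R\|_\infty^2+\lambda D_{\mathrm{KL}}(\theta,u),$$ where $\|\hat R-R\|_\infty=\sup_\beta|\hat R(\beta)-R(\beta)|$. The same bound applies (with $\theta_T$ in place of $\hat\theta_\lambda$) to exponentiated gradient descent $\tilde\theta_{t+1}=\theta_t\odot\exp(-\eta\nabla f(\theta_t))$, $\theta_{t+1}=\tilde\theta_{t+1}/\|\tilde\theta_{t+1}\|_1$ with the loss $f(\theta)=\mathbb{E}_{\beta\sim\theta}[\hat R(\beta)]$, constant step size $\eta>0$ and $\theta_0=u$, provided $T=1/(\eta\lambda)$ is an integer. Furthermore, if the loss $\ell$ is bounded by $C>0$ and the training samples are i.i.d., then for any $\delta>0$ and $b>0$, with probability at least $1-e^{-\delta}$, $$\mathbb{E}_{\beta\sim\hat\theta_\lambda}[R(\beta)]-\min_{\theta:\,D_{\mathrm{KL}}(\theta,u)\le b}\mathbb{E}_{\beta\sim\theta}[R(\beta)]\le\frac{C^2(\log(2d)+\delta)}{4n\lambda}+\lambda b.$$ In particular, choosing $\lambda=\frac C2\sqrt{\frac{\log(2d)+\delta}{bn}}$,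 with probability at least $1-e^{-\delta}$, $$\mathbb{E}_{\beta\sim\hat\theta_\lambda}[R(\beta)]-\min_{\theta:\,D_{\mathrm{KL}}(\theta,u)\le b}\mathbb{E}_{\beta\sim\theta}[R(\beta)]\le C\sqrt{\frac{b(\log(2d)+\delta)}{n}}.$$ The same result again applies to exponentiated gradient descent provided $T=1/(\eta\lambda)$ is an integer.
   Context: $X_1,\dots,X_d\in\mathbb{R}^n$ are base predictors, $Y\in\mathbb{R}^n$ is a response vector, and $\ell$ is an arbitrary loss function. For $\theta\in\Delta_d=\{a\in\mathbb{R}^d:a_i\ge0,\ \sum_{i=1}^d a_i=1\}$, $\beta\sim\theta$ denotes the randomized predictor that is the $j$th base predictor with probability $\theta_j$, $j=1,\dots,d$; then $\beta(X)=X_j$ on training data and $\beta(X^* )=X_j^*$ on test data, where $X_j^*\in\mathbb{R}^n$, $j=1,\dots,d$, and $Y^*\in\mathbb{R}^n$ are test instances of the base predictors and the response. Training risk: $\hat R(\beta)=\frac1n\sum_{i=1}^n\ell(\beta(X)_i,Y_i)$. Test risk: $R(\beta)=\mathbb{E}\big[\frac1n\sum_{i=1}^n\ell(\beta(X^* )_i,Y_i^* )\big]$, the expectation being with respect to any joint distribution $P$ on $(X^*,Y^* )$. Expectations $\mathbb{E}_{\beta\sim\theta}$ are only over the draw of $\beta$, e.g. $\mathbb{E}_{\beta\sim\theta}[R(\beta)]=\sum_j\theta_jR(\beta_j)$ with $\beta_j$ the $j$th base predictor; $\sup_\beta$ is over the $d$ base predictors. $D_{\mathrm{KL}}(a,b)=\sum_{i=1}^d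 a_i\log(a_i/b_i)$ (with $0\log0=0$, and $+\infty$ if $a_i>0=b_i$ for some $i$). $\odot$ is coordinatewise multiplication and $\exp$ acts coordinatewise.
   Formalization: In the high-probability part, each test sample is assumed to have the same law as the training samples, and ''bounded by C'' is read as 0 ≤ ℓ ≤ C with ℓ Borel measurable; for an unrelated test distribution, or only |ℓ| ≤ C, the stated bound is false. *)

(* Defs.v *)
From HB Require Import structures.
From mathcomp Require Import all_boot all_order all_algebra.
From mathcomp Require Import all_classical all_reals all_analysis.

Set Implicit Arguments.
Unset Strict Implicit.
Unset Printing Implicit Defensive.

Import Order.TTheory GRing.Theory Num.Theory.
Import numFieldNormedType.Exports.

Local Open Scope classical_set_scope.
Local Open Scope ring_scope.

Section Simplex.
Context {R : realType} {d : nat}.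
Implicit Types a b theta : 'rV[R]_d.

Definition simplex : set 'rV[R]_d :=
  [set a | (forall i, 0 <= a 0 i) /\ \sum_i a 0 i = 1].

Definition KL_term (x y : R) : \bar R :=
  if x == 0 then 0%E else if y == 0 then +oo%E else (x * ln (x / y))%:E.

(* No summand is -oo, so the sum is +oo as soon as one of them is. *)
Definition DKL a b : \bar R := (\sum_i KL_term (a ord0 i) (b ord0 i))%E.

(* Expectation over the draw of the predictor only.  The risk of a predictor
   may be infinite, and then 0 * oo = 0. *)
Definition mean theta (r : 'I_d -> \bar R) : \bar R :=
  (\sum_j (theta ord0 j)%:E * r j)%E.

(* The same expectation for finite risks, as a function on the whole of R^d so
   that it can be differentiated. *)
Definition fmean (r : 'I_d -> R) theta : R := \sum_j theta 0 j * r j.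

Definition dist_sup (r s : 'I_d -> \bar R) : \bar R :=
  ereal_sup (range (fun j => `|r j - s j|%E)).

Definition is_argmin {T : Type} (S : set T) (F : T -> \bar R) (x : T) : Prop :=
  S x /\ forall y, S y -> (F x <= F y)%E.

Definition gibbs_posterior (rhat : 'I_d -> R) (lambda : R) (u : 'rV[R]_d)
    : 'rV[R]_d -> Prop :=
  is_argmin simplex
    (fun theta => (fmean rhat theta)%:E + lambda%:E * DKL theta u)%E.

Definition KL_ball (u : 'rV[R]_d) (b : R) : set 'rV[R]_d :=
  [set theta | simplex theta /\ (DKL theta u <= b%:E)%E].

Definition gradient (f : 'rV[R]_d -> R) theta : 'rV[R]_d :=
  \row_j 'D_(delta_mx 0 j) f theta.

Definition norm1 a : R := \sum_j `|a 0 j|.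

Definition egd_step (eta : R) (f : 'rV[R]_d -> R) theta : 'rV[R]_d :=
  let theta' := \row_j (theta 0 j * expR (- eta * gradient f theta 0 j)) in
  (norm1 theta')^-1 *: theta'.

Definition egd (eta : R) (f : 'rV[R]_d -> R) (u : 'rV[R]_d) (t : nat)
    : 'rV[R]_d := iter t (egd_step eta f) u.

End Simplex.

Section Risk.
Context {R : realType} {d n : nat}.

Definition avg_loss (ell : R -> R -> R) (x y : 'rV[R]_n) : R :=
  n%:R^-1 * \sum_i ell (x 0 i) (y 0 i).

Definition train_risk (ell : R -> R -> R) (X : 'I_d -> 'rV[R]_n)
  (Y : 'rV[R]_n) (j : 'I_d) : R := avg_loss ell (X j) Y.

(* A data set is a family of n samples; sample i is the pair
   ((X_{1,i}, ..., X_{d,i}), Y_i). *)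
Definition predictors (z : 'I_n -> d.-tuple R * R) (j : 'I_d) : 'rV[R]_n :=
  \row_i tnth (z i).1 j.

Definition response (z : 'I_n -> d.-tuple R * R) : 'rV[R]_n := \row_i (z i).2.

Definition test_risk (ell : R -> R -> R) (dQ : measure_display)
    (Omega : measurableType dQ) (Q : probability Omega R)
    (Z : 'I_n -> {RV Q >-> (d.-tuple R * R)%type}) (j : 'I_d) : \bar R :=
  'E_Q[fun w => avg_loss ell (predictors (fun i => Z i w) j)
                             (response (fun i => Z i w))].

End Risk.

Section Probability.
Context {R : realType} (dP dQ dS : measure_display).
Context (OmegaP : measurableType dP) (OmegaQ : measurableType dQ).
Context (S : measurableType dS).
Context (P : probability OmegaP R) (Q : probability OmegaQ R).

Definition same_law (X : {RV P >-> S}) (Y : {RV Q >-> S}) : Prop :=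
  forall A : set S, measurable A -> distribution P X A = distribution Q Y A.

Definition independent_RVs (n : nat) (Z : 'I_n -> {RV P >-> S}) : Prop :=
  forall (J : {set 'I_n}) (A : 'I_n -> set S), (forall i, measurable (A i)) ->
    P (\bigcap_(i in [set` J]) (Z i @^-1` A i)) =
    (\prod_(i in J) P (Z i @^-1` A i))%E.

Definition with_prob_at_least (p : R) (E : set OmegaP) : Prop :=
  measurable E /\ (p%:E <= P E)%E.

End Probability.

Definition iid {R : realType} {dP dS : measure_display}
    {OmegaP : measurableType dP} {S : measurableType dS}
    (P : probability OmegaP R) (n : nat) (Z : 'I_n -> {RV P >-> S}) : Prop :=
  independent_RVs Z /\ forall i k, same_law (Z i) (Z k).

(* Main.v *)
Require Import Defs.
From HB Require Import structures.
From mathcomp Require Import all_boot all_order all_algebra.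
From mathcomp Require Import all_classical all_reals all_analysis.
From mathcomp Require Import measurable_realfun.
From mathcomp Require Import ring lra.

Set Implicit Arguments.
Unset Strict Implicit.
Unset Printing Implicit Defensive.

Import Order.TTheory GRing.Theory Num.Theory.
Import numFieldNormedType.Exports.

Local Open Scope classical_set_scope.
Local Open Scope ring_scope.

(** Both algorithms return the same vector, the exponential tilt q of the prior
    whose weights are proportional to u_j exp (- rhat_j / lambda)
    ([gibbs u rhat lambda]).  For the Gibbs posterior this is the Gibbs
    variational principle: up to a constant the regularised objective equals
    lambda KL(theta, q), which vanishes only at q ([gibbs_posteriorP]).  For
    exponentiated gradient descent the loss is linear, so every round multiplies
    weight j by the same exp (- eta rhat_j), up to normalisation, and T rounds
    give the tilt by exp (- T eta rhat_j), with T eta = 1 / lambda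
    ([egd_gibbs]).

    The excess risk of q over theta is the sum of (q - theta) . rhat and
    (q - theta) . (r - rhat).  The variational principle, applied at theta and
    at q, bounds the first summand by lambda KL(theta, u) - lambda KL(theta, q).
    The second is a change of measure from q to theta: by the Donsker-Varadhan
    inequality it costs lambda KL(theta, q) plus lambda times the logarithm of
    the moment generating function of the centred r - rhat under q, and
    Hoeffding's lemma bounds the latter by eps^2 / (2 lambda) when
    |rhat - r| <= eps ([mean_diff_le]).  The two KL(theta, q) cancel
    ([gibbs_excess_risk_le]).  If a risk or KL(theta, u) is infinite, the claimed
    bound is +oo.

    For i.i.d. samples the test risk is the common mean of the losses
    ([test_risk_iid]), and Hoeffding's inequality with a union bound over the two
    tails of the d predictors gives |rhat - r| <= s with probability at least
    1 - exp (- delta), where s^2 = C^2 (ln (2 d) + delta) / (2 n)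
    ([uniform_hoeffding]).  Inserting eps = s in the deterministic bound gives
    the result; the special lambda makes its two terms equal.  Hoeffding's
    inequality needs the moment generating function of a sum of independent
    variables to factor, so the product rule for events is first extended to
    nonnegative functions ([integral_prod_independent]).  The minimum over the KL
    ball is attained because the ball is an intersection of closed half-spaces
    with the simplex, again by Donsker-Varadhan duality ([KL_ball_dual]). *)

(** * Hoeffding's lemma *)

Section ScalarHoeffding.
Context {R : realType}.
Implicit Types (f df : R -> R) (a b m p t x y : R).

Lemma ge0_derive_ge0 f df : (forall x, is_derive x 1 f (df x)) ->
  (forall x, 0 <= x -> 0 <= df x) -> f 0 = 0 -> forall x, 0 <= x -> 0 <= f x.
Proof.
move=> fdf df0 f0 x x0.
have [c /itvP cx] : exists2 c, c \in `[0, x] & f x - f 0 = df c * (x - 0).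
  apply: MVT_segment => //.
  apply: continuous_subspaceT => y; apply: differentiable_continuous.
  by apply/derivable1_diffP; have [] := fdf y.
by rewrite f0 !subr0 => ->; rewrite mulr_ge0// df0// cx.
Qed.

(** The logarithm of the moment generating function of a Bernoulli(p) variable has
    second derivative q (1 - q) <= 1/4, where q is the success probability after
    tilting by exp t.  Twice the mean value theorem on [0, t] gives t^2 / 8;
    exchanging the two outcomes reduces t < 0 to t > 0. *)
Lemma bernoulli_mgf_le p t : 0 <= p <= 1 ->
  1 - p + p * expR t <= expR (t * p + t ^+ 2 / 8).
Proof.
wlog t0 : p t / 0 <= t.
  move=> ge0_case p01; have [t0|/ltW t0] := leP 0 t; first exact: ge0_case.
  have nt0 : 0 <= - t by rewrite oppr_ge0.
  have q01 : 0 <= 1 - p <= 1 by lra.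
  have /(ler_wpM2l (expR_ge0 t)) := ge0_case _ _ nt0 q01.
  rewrite -expRD mulrDr mulrCA -expRD subrr expR0 mulr1.
  by congr (_ <= _); [ring | congr expR; ring].
move=> /andP[p0 p1].
pose w x : R := 1 - p + p * expR x.
have w_gt0 x : 0 < w x.
  rewrite /w; have [->|pn0] := eqVneq p 0; first lra.
  by rewrite ltr_wpDl ?subr_ge0// mulr_gt0 ?expR_gt0// lt_neqAle eq_sym pn0.
have dw x : is_derive x 1 w (p * expR x).
  rewrite /w; apply: is_derive_eq; by rewrite add0r /GRing.scale/=; ring.
pose phi' x : R := x / 4 + p - p * expR x / w x.
have dphi' x : is_derive x 1 phi' (1 / 4 - p * (1 - p) * expR x / w x ^+ 2).
  have wV : is_derive x 1 (fun y => (w y)^-1) (- (w x) ^- 2 *: (p * expR x)).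
    by apply: is_deriveV; rewrite gt_eqF.
  rewrite /phi'; apply: is_derive_eq.
  rewrite /GRing.scale/=.
  by have := gt_eqF (w_gt0 x); rewrite /w => wx0; field; rewrite wx0.
pose phi x : R := x ^+ 2 / 8 + x * p - ln (w x).
have dphi x : is_derive x 1 phi (phi' x).
  have lnw : is_derive x 1 (fun y => ln (w y)) ((w x)^-1 * (p * expR x)).
    exact: (@is_derive1_comp R (@ln R) w x _ _ (is_derive1_ln (w_gt0 x)) (dw x)).
  rewrite /phi; apply: is_derive_eq.
  by rewrite /phi' /GRing.scale/=; field; rewrite gt_eqF.
have w0 : w 0 = 1 by rewrite /w expR0; ring.
have phi'0 : phi' 0 = 0 by rewrite /phi' w0 expR0; field.
have phi0 : phi 0 = 0 by rewrite /phi w0 ln1; field.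
have phi'_ge0 := ge0_derive_ge0 dphi'.
have : 0 <= phi t.
  apply: (ge0_derive_ge0 dphi) => // x x0; apply: phi'_ge0 => // y y0.
  rewrite subr_ge0 ler_pdivrMr ?exprn_gt0//.
  (* AM-GM: w y ^ 2 - 4 p (1 - p) exp y is this square. *)
  have : 0 <= (1 - p - p * expR y) ^+ 2 by apply: sqr_ge0.
  by rewrite /w; lra.
rewrite /phi subr_ge0 -ler_expR lnK ?posrE//.
by congr (_ <= expR _); ring.
Qed.

(** Hoeffding's lemma before any expectation is taken: exp lies below its chord over
    [a, b], and the height of the chord at m is a Bernoulli moment generating
    function.  Averaging against a law with mean m cancels the linear term, so the
    same inequality serves for a probability vector and for a random variable. *)
Lemma hoeffding_chord a b m t : a <= m <= b -> exists beta : R, forall x,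
  a <= x <= b ->
  expR (t * (x - m)) <= expR (t ^+ 2 * (b - a) ^+ 2 / 8) + beta * (x - m).
Proof.
move=> /andP[am mb]; have [ab|ab] := eqVneq a b.
  exists 0 => x /andP[ax xb]; have -> : x = m by lra.
  by rewrite subrr mulr0 mul0r addr0 ler_expR ab subrr; lra.
have ab0 : 0 < b - a by rewrite subr_gt0 lt_neqAle ab (le_trans am).
pose ea := expR (t * (a - m)); pose eb := expR (t * (b - m)).
exists ((eb - ea) / (b - a)) => x /andP[ax xb].
pose p := (m - a) / (b - a); pose q := (x - a) / (b - a).
have frac01 y : a <= y <= b -> 0 <= (y - a) / (b - a) <= 1.
  move=> /andP[ay yb]; rewrite ler_pdivrMr// ler_pdivlMr//.
  by apply/andP; split; lra.
have p01 : 0 <= p <= 1 by apply: frac01; rewrite am mb.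
have q01 : 0 <= q <= 1 by apply: frac01; rewrite ax xb.
have ba0 : b - a != 0 by rewrite gt_eqF.
(* Convexity of exp, as the mean of two tangent inequalities at t (x - m). *)
have chord : expR (t * (x - m)) <= (1 - q) * ea + q * eb.
  pose z := t * (x - m).
  have tangent y : expR z * (1 + (y - z)) <= expR y.
    rewrite -[leRHS](_ : expR z * expR (y - z) = _); last first.
      by rewrite -expRD addrC subrK.
    by rewrite ler_wpM2l ?expR_ge0// expR_ge1Dx.
  have zE : z = (1 - q) * (t * (a - m)) + q * (t * (b - m)).
    by rewrite /z /q; field.
  have /andP[q0 q1] := q01; have q1' : 0 <= 1 - q by rewrite subr_ge0.
  apply: le_trans (lerD (ler_wpM2l q1' (tangent (t * (a - m))))
                        (ler_wpM2l q0 (tangent (t * (b - m))))).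
  rewrite le_eqVlt; apply/orP; left; apply/eqP.
  transitivity (expR z * (1 + ((1 - q) * (t * (a - m)) + q * (t * (b - m)) - z))); last by ring.
  by rewrite -zE subrr addr0 mulr1.
apply: (le_trans chord).
have -> : (1 - q) * ea + q * eb
    = (1 - p) * ea + p * eb + (eb - ea) / (b - a) * (x - m).
  by rewrite /p /q; field.
rewrite lerD2r.
have := ler_wpM2l (expR_ge0 (t * (a - m))) (bernoulli_mgf_le (t * (b - a)) p01).
rewrite -expRD; congr (_ <= expR _); last by rewrite /p; field.
rewrite mulrDr -/ea mulrCA -expRD -mulrDr [a - m + _]addrC.
by rewrite (_ : b - a + (a - m) = b - m) 1?mulrC//; ring.
Qed.

End ScalarHoeffding.

(** * Relative entropy and exponential tilting *)

Section KullbackLeibler.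
Context {R : realType} {d : nat}.
Implicit Types (a b u theta : 'rV[R]_d) (h g r : 'I_d -> R)
  (x y lambda eps : R).

Lemma simplex_dim_gt0 a : simplex a -> (0 < d)%N.
Proof.
move=> [_ a1]; rewrite lt0n; apply: contra_eq_neq a1 => d0.
rewrite big1 ?(eq_sym 0) ?oner_eq0// => j _.
by have := ltn_ord j; rewrite [X in (_ < X)%N]d0.
Qed.

Definition dominated a b := forall j, b 0 j = 0 -> a 0 j = 0.

(** Real-valued, and meant for dominated vectors only.  A coordinate with
    a_j = b_j = 0 contributes 0 * ln (0 / 0) = 0. *)
Definition rKL a b : R := \sum_j a 0 j * ln (a 0 j / b 0 j).

Lemma DKL_dominated a b : dominated a b -> DKL a b = (rKL a b)%:E.
Proof.
move=> ab; rewrite /DKL /rKL -sumEFin; apply: eq_bigr => j _; rewrite /KL_term.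
by case: eqP => [->|aj0]; [rewrite mul0r | case: eqP => // /ab].
Qed.

Lemma DKL_not_dominated a b : ~ dominated a b -> DKL a b = +oo%E.
Proof.
move=> /existsNP[j] /not_implyP[bj0 /eqP/negPf aj0].
apply/esum_eqyP => [i _|]; first by rewrite /KL_term; case: ifP => // _; case: ifP.
by exists j; split => //; rewrite /KL_term aj0 bj0 eqxx.
Qed.

(** For x > 0 this is x times 1 + z <= exp z at z = ln (y / x), with its equality case. *)
Lemma ln_ratio_ge x y : 0 <= x -> 0 <= y -> (y = 0 -> x = 0) ->
  x - y <= x * ln (x / y) /\ (x * ln (x / y) = x - y -> x = y).
Proof.
move=> x0 y0 yx; have [->|xn0] := eqVneq x 0.
  by rewrite mul0r sub0r oppr_le0; split => // /eqP; rewrite eq_sym oppr_eq0 => /eqP.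
have xp : 0 < x by rewrite lt_neqAle eq_sym xn0.
have yp : 0 < y.
  by rewrite lt_neqAle y0 andbT; apply: contra_neq xn0 => /esym.
have -> : ln (x / y) = - ln (y / x) by rewrite -lnV ?posrE ?divr_gt0// invf_div.
set z := ln (y / x).
have yE : y = x * expR z.
  by rewrite lnK ?posrE ?divr_gt0// mulrCA divff// mulr1.
split.
  have := ler_wpM2l x0 (expR_ge1Dx z); rewrite -yE; lra.
move=> eqz; have [z0|/expR_gt1Dx] := eqVneq z 0.
  by rewrite yE z0 expR0 mulr1.
by rewrite -(ltr_pM2l xp) -yE; move: eqz; lra.
Qed.

Lemma rKL_ge a b : (forall j, 0 <= a 0 j) -> (forall j, 0 <= b 0 j) ->
  dominated a b -> \sum_j a 0 j - \sum_j b 0 j <= rKL a b.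
Proof.
move=> a0 b0 ab; rewrite -sumrB; apply: ler_sum => j _.
by have [] := ln_ratio_ge (a0 j) (b0 j) (ab j).
Qed.

Lemma rKL_ge0 a b : simplex a -> simplex b -> dominated a b -> 0 <= rKL a b.
Proof.
by move=> [a0 a1] [b0 b1] ab; have := rKL_ge a0 b0 ab; rewrite a1 b1 subrr.
Qed.

Lemma rKL_eq0 a b : simplex a -> simplex b -> dominated a b ->
  rKL a b = 0 -> a = b.
Proof.
move=> [a0 a1] [b0 b1] ab kl0; apply/rowP => j.
have ge j' := ln_ratio_ge (a0 j') (b0 j') (ab j').
have : \sum_j (a 0 j * ln (a 0 j / b 0 j) - (a 0 j - b 0 j)) = 0.
  by rewrite !sumrB a1 b1 subrr subr0.
move=> /eqP; rewrite psumr_eq0 => [/allP/(_ j)|i _]; last first.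
  by rewrite subr_ge0; have [] := ge i.
by rewrite mem_index_enum subr_eq0 => /(_ isT)/eqP; have [_] := ge j.
Qed.

Lemma rKLxx a : rKL a a = 0.
Proof.
apply: big1 => j _; have [->|aj0] := eqVneq (a 0 j) 0; first by rewrite mul0r.
by rewrite divff// ln1 mulr0.
Qed.

Definition tilt u h : 'rV[R]_d := \row_j (u 0 j * expR (h j)).

Lemma tilt_ge0 u h : simplex u -> forall j, 0 <= tilt u h 0 j.
Proof. by move=> [u0 _] j; rewrite mxE mulr_ge0// expR_ge0. Qed.

Lemma dominated_tilt a u h : dominated a u -> dominated a (tilt u h).
Proof.
move=> au j; rewrite mxE => /eqP; rewrite mulf_eq0 expR_eq0 orbF => /eqP.
exact: au.
Qed.

(** The identity behind [gibbs_variational] and [mean_diff_le]: tilting the reference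
    measure changes the relative entropy by a linear functional. *)
Lemma rKL_tilt a u h : (forall j, 0 <= a 0 j) -> (forall j, 0 <= u 0 j) ->
  dominated a u -> rKL a (tilt u h) = rKL a u - fmean h a.
Proof.
move=> a0 u0 au; rewrite /rKL /fmean -sumrB; apply: eq_bigr => j _.
rewrite -mulrBr mxE; have [->|aj0] := eqVneq (a 0 j) 0; first by rewrite !mul0r.
have ajp : 0 < a 0 j by rewrite lt_neqAle eq_sym aj0 a0.
have ujp : 0 < u 0 j.
  by rewrite lt_neqAle u0 andbT; apply: contra_neq aj0 => /esym/au.
by rewrite !ln_div ?posrE ?mulr_gt0 ?expR_gt0// lnM ?posrE ?expR_gt0// expRK opprD addrA.
Qed.

Definition softmax u h : 'rV[R]_d := (norm1 (tilt u h))^-1 *: tilt u h.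

Lemma norm1_tilt u h : simplex u -> norm1 (tilt u h) = \sum_j tilt u h 0 j.
Proof. by move=> us; apply: eq_bigr => j _; rewrite ger0_norm// tilt_ge0. Qed.

Lemma norm1_tilt_gt0 u h : simplex u -> 0 < norm1 (tilt u h).
Proof.
move=> us; rewrite lt_neqAle; apply/andP; split; last first.
  by apply: sumr_ge0 => j _.
rewrite eq_sym; apply/eqP; rewrite norm1_tilt// => /eqP.
rewrite psumr_eq0 => [/allP tilt0|i _]; last exact: tilt_ge0.
have [_] := us; rewrite big1 => [/esym/eqP|j _]; first by rewrite oner_eq0.
have := tilt0 j; rewrite mem_index_enum => /(_ isT).
by rewrite mxE mulf_eq0 expR_eq0 orbF => /eqP.
Qed.

(** Normalisation is a constant shift of the exponent, so that [rKL_tilt] applies to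
    normalised tilts as well. *)
Lemma softmaxE u h : simplex u ->
  softmax u h = tilt u (fun j => h j - ln (norm1 (tilt u h))).
Proof.
move=> us; apply/rowP => j; rewrite !mxE expRB lnK ?posrE ?norm1_tilt_gt0//.
by rewrite mulrC mulrA.
Qed.

Lemma simplex_softmax u h : simplex u -> simplex (softmax u h).
Proof.
move=> us; split=> [j|].
  by rewrite mxE mulr_ge0 ?tilt_ge0// invr_ge0 ltW// norm1_tilt_gt0.
under eq_bigr do rewrite mxE.
by rewrite -mulr_sumr -norm1_tilt// mulVf// gt_eqF// norm1_tilt_gt0.
Qed.

Lemma dominated_softmax u h : simplex u -> dominated (softmax u h) u.
Proof. by move=> us j uj0; rewrite softmaxE// mxE uj0 mul0r. Qed.

(** Exponents of successive tilts add up, and intermediate normalisations cancel. *)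
Lemma softmax_softmax u h g : simplex u ->
  softmax (softmax u h) g = softmax u (fun j => h j + g j).
Proof.
move=> us; set c := (norm1 (tilt u h))^-1.
have c_gt0 : 0 < c by rewrite invr_gt0 norm1_tilt_gt0.
have tiltE : tilt (softmax u h) g = c *: tilt u (fun j => h j + g j).
  by apply/rowP => j; rewrite !mxE -/c expRD !mulrA.
rewrite /softmax -/(softmax u h) tiltE.
have -> : norm1 (c *: tilt u (fun j => h j + g j))
    = c * norm1 (tilt u (fun j => h j + g j)).
  rewrite /norm1 mulr_sumr; apply: eq_bigr => j _.
  by rewrite mxE normrM (gtr0_norm c_gt0).
by rewrite scalerA invfM mulrAC mulVf ?mul1r// gt_eqF.
Qed.

Lemma fmean_cst c a : simplex a -> fmean (fun=> c) a = c.
Proof. by move=> [_ a1]; rewrite /fmean -mulr_suml a1 mul1r. Qed.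

Lemma fmeanB h g a : fmean (fun j => h j - g j) a = fmean h a - fmean g a.
Proof. by rewrite /fmean -sumrB; apply: eq_bigr => j _; rewrite mulrBr. Qed.

Lemma fmeanZ c h a : fmean (fun j => c * h j) a = c * fmean h a.
Proof. by rewrite /fmean mulr_sumr; apply: eq_bigr => j _; rewrite mulrCA. Qed.

Lemma mean_fin r a : mean a (fun j => (r j)%:E) = (fmean r a)%:E.
Proof. by rewrite /mean /fmean -sumEFin; apply: eq_bigr. Qed.

(** As the relative entropy on the right is nonnegative, this contains the
    Donsker-Varadhan inequality fmean h a <= rKL a u + ln E_u exp h. *)
Lemma gibbs_variational u h a : simplex u -> simplex a -> dominated a u ->
  rKL a u - fmean h a = rKL a (softmax u h) - ln (norm1 (tilt u h)).
Proof.
move=> us as_ au; rewrite softmaxE// rKL_tilt//; [|exact: as_.1|exact: us.1].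
by rewrite fmeanB fmean_cst//; ring.
Qed.

(** Change of measure from [b] to [a].  The tilt of [b] by
    - (g - E_b g) / lambda - s has total mass at most 1, by Hoeffding's lemma on the
    range [- eps, eps] with s its exponent; relative entropy to a measure of mass at
    most 1 is nonnegative, and [rKL_tilt] turns this into the claim. *)
Lemma mean_diff_le lambda eps a b g : 0 < lambda -> simplex a -> simplex b ->
    dominated a b -> (forall j, `|g j| <= eps) ->
  fmean g b - fmean g a <= lambda * rKL a b + eps ^+ 2 / (2 * lambda).
Proof.
move=> l0 as_ bs ab geps; set m := fmean g b.
pose s : R := (- lambda^-1) ^+ 2 * (eps - - eps) ^+ 2 / 8.
have [beta betaP] : exists beta : R, forall x, - eps <= x <= eps ->
    expR (- lambda^-1 * (x - m)) <= expR s + beta * (x - m).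
  have geps' j : - eps <= g j <= eps by rewrite -ler_norml.
  apply: hoeffding_chord; apply/andP; split.
    rewrite -[leLHS](fmean_cst (- eps) bs); apply: ler_sum => j _.
    by apply: ler_wpM2l; rewrite ?(bs.1)//; have /andP[] := geps' j.
  rewrite -[leRHS](fmean_cst eps bs); apply: ler_sum => j _.
  by apply: ler_wpM2l; rewrite ?(bs.1)//; have /andP[] := geps' j.
pose h (j : 'I_d) : R := - lambda^-1 * (g j - m) - s.
have tilt_le1 : \sum_j tilt b h 0 j <= 1.
  apply: (@le_trans _ _ (\sum_j b 0 j * (1 + expR (- s) * beta * (g j - m)))).
    apply: ler_sum => j _; rewrite mxE ler_wpM2l ?(bs.1)// /h expRD.
    have := betaP (g j); rewrite -ler_norml geps => /(_ isT).
    move=> /(ler_wpM2r (expR_ge0 (- s))); rewrite mulrDl expRxMexpNx_1.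
    by move=> /le_trans; apply; rewrite le_eqVlt; apply/orP; left; apply/eqP; ring.
  rewrite -/(fmean _ b).
  have -> : fmean (fun j => 1 + expR (- s) * beta * (g j - m)) b =
      fmean (fun=> 1) b + expR (- s) * beta * (fmean g b - fmean (fun=> m) b).
    rewrite -fmeanB -fmeanZ /fmean -big_split/=.
    by apply: eq_bigr => j _; rewrite mulrDr.
  by rewrite !fmean_cst// subrr mulr0 addr0.
have := rKL_ge as_.1 (tilt_ge0 h bs) (dominated_tilt (h := h) ab).
rewrite rKL_tilt//; [|exact: as_.1|exact: bs.1].
have -> : fmean h a = - lambda^-1 * (fmean g a - m) - s.
  by rewrite /h fmeanB fmeanZ fmeanB !fmean_cst.
have sE : lambda * s = eps ^+ 2 / (2 * lambda) by rewrite /s; field; rewrite gt_eqF.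
rewrite as_.2 => kl_ge.
have : 0 <= rKL a b - (- lambda^-1 * (fmean g a - m) - s).
  by apply: le_trans kl_ge; rewrite subr_ge0.
move=> /(mulr_ge0 (ltW l0)).
have -> : lambda * (rKL a b - (- lambda^-1 * (fmean g a - m) - s)) =
  lambda * rKL a b + lambda * lambda^-1 * (fmean g a - m) + lambda * s by ring.
by rewrite divff ?gt_eqF// mul1r sE; lra.
Qed.

Definition gibbs u r lambda := softmax u (fun j => - lambda^-1 * r j).

(** Apply [gibbs_variational] at [a] and at the posterior itself to compare empirical
    means, and [mean_diff_le] to pass from [rhat] to [r]; the relative entropies of
    [a] to the posterior cancel. *)
Lemma gibbs_excess_risk_le lambda eps u a rhat r :
    0 < lambda -> simplex u -> simplex a -> dominated a u ->
    (forall j, `|rhat j - r j| <= eps) ->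
  fmean r (gibbs u rhat lambda) - fmean r a <=
    eps ^+ 2 / (2 * lambda) + lambda * rKL a u.
Proof.
move=> l0 us as_ au rhateps; set q := gibbs _ _ _.
have qs : simplex q by apply: simplex_softmax.
have qu : dominated q u by apply: dominated_softmax.
have aq : dominated a q by rewrite /q /gibbs softmaxE//; exact: dominated_tilt.
have /(mean_diff_le l0 as_ qs aq) : forall j, `|r j - rhat j| <= eps.
  by move=> j; rewrite distrC.
rewrite !fmeanB.
have := gibbs_variational (fun j => - lambda^-1 * rhat j) us as_ au.
have := gibbs_variational (fun j => - lambda^-1 * rhat j) us qs qu.
have := mulr_ge0 (ltW l0) (rKL_ge0 qs us qu).
rewrite -/(gibbs _ _ _) -/q rKLxx !fmeanZ.
set lz := ln _ => kl0 /(congr1 ( *%R lambda)) eq1 /(congr1 ( *%R lambda)).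
move: eq1; rewrite !mulrBr !mulrA !mulrN divff ?gt_eqF// mulr0.
lra.
Qed.

End KullbackLeibler.

(** * Gibbs posterior, exponentiated gradient descent and KL balls *)

Section GibbsPosterior.
Context {R : realType} {d : nat}.
Implicit Types (u theta a : 'rV[R]_d) (rhat r h : 'I_d -> R) (lambda eta : R).

Lemma gibbs_objective rhat lambda u a : 0 < lambda -> simplex u -> simplex a ->
    dominated a u ->
  fmean rhat a + lambda * rKL a u = lambda * rKL a (gibbs u rhat lambda)
    - lambda * ln (norm1 (tilt u (fun j => - lambda^-1 * rhat j))).
Proof.
move=> l0 us as_ au.
have := gibbs_variational (fun j => - lambda^-1 * rhat j) us as_ au.
rewrite -/(gibbs _ _ _) fmeanZ => /(congr1 ( *%R lambda)).
by rewrite !mulrBr !mulrA !mulrN divff ?gt_eqF//; lra.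
Qed.

(** On dominated vectors the objective is a constant plus lambda times the relative
    entropy to [gibbs u rhat lambda], and it is +oo elsewhere; relative entropy
    vanishes only on the diagonal. *)
Lemma gibbs_posteriorP rhat lambda u q : 0 < lambda -> simplex u ->
  gibbs_posterior rhat lambda u q <-> q = gibbs u rhat lambda.
Proof.
move=> l0 us; set g := gibbs u rhat lambda.
have gs : simplex g by apply: simplex_softmax.
have gu : dominated g u by apply: dominated_softmax.
have dom_g a : dominated a u -> dominated a g.
  by move=> au; rewrite /g /gibbs softmaxE//; exact: dominated_tilt.
split=> [[qs qmin]|->]; last first.
  split=> // a as_; have [au|/DKL_not_dominated ->] := pselect (dominated a u).
    rewrite !DKL_dominated// -!EFinM -!EFinD lee_fin !gibbs_objective// -/g rKLxx.
    by rewrite lerD2r ler_pM2l// rKL_ge0//; exact: dom_g.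
  by rewrite gt0_muley ?lte_fin// addey// leey.
have qu : dominated q u.
  apply: contrapT => /DKL_not_dominated qoo; have := qmin _ gs.
  by rewrite qoo gt0_muley ?lte_fin// addey// DKL_dominated.
have := qmin _ gs.
rewrite !DKL_dominated// -!EFinM -!EFinD lee_fin !gibbs_objective// -/g rKLxx.
rewrite lerD2r ler_pM2l// => kl0.
apply: rKL_eq0 => //; first exact: dom_g.
by apply/eqP; rewrite eq_le kl0 rKL_ge0//; exact: dom_g.
Qed.

Lemma gradient_fmean r a : gradient (fmean r) a = \row_j r j.
Proof.
apply/rowP => j; rewrite !mxE /derive; apply: cvg_lim => //.
apply: (@cvg_trans _ ((cst (r j) : R -> R) @ 0^')); last exact: cvg_cst.
apply: near_eq_cvg; near=> t => /=.
have t0 : t != 0 by near: t; exact: nbhs_dnbhs_neq.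
rewrite /fmean -sumrB (bigD1 j)//= big1 => [|i ij].
  rewrite !mxE !eqxx /GRing.scale/= addr0; field.
  exact: t0.
by rewrite !mxE eqxx (negPf ij) /= mulr0 add0r subrr.
Unshelve. all: by end_near. Qed.

Lemma egd_softmax eta r u t : simplex u ->
  egd eta (fmean r) u t = softmax u (fun j => - (t%:R * eta) * r j).
Proof.
move=> us; elim: t => [|t IH].
  have tilt0 : tilt u (fun j => - (0%:R * eta) * r j) = u.
    by apply/rowP => j; rewrite !mxE mul0r oppr0 mul0r expR0 mulr1.
  rewrite /softmax tilt0 /egd/=.
  have -> : norm1 u = 1 by rewrite -tilt0 norm1_tilt// tilt0 us.2.
  by rewrite invr1 scale1r.
rewrite /egd iterS -/(egd eta (fmean r) u t) IH /egd_step gradient_fmean.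
rewrite -[LHS]/(softmax (softmax u (fun j => - (t%:R * eta) * r j))
  (fun j => - eta * (\row_j r j) 0 j)).
rewrite softmax_softmax//; congr softmax; apply/funext => j.
by rewrite mxE -natr1; ring.
Qed.

Lemma egd_gibbs eta lambda r u T : 0 < eta -> T%:R = 1 / (eta * lambda) ->
  simplex u -> egd eta (fmean r) u T = gibbs u r lambda.
Proof.
move=> eta0 TE us; rewrite egd_softmax// /gibbs; congr softmax.
apply/funext => j; rewrite TE div1r invfM mulrAC mulVf ?gt_eqF// mul1r.
by [].
Qed.

Lemma dist_sup_ge (r s : 'I_d -> \bar R) j :
  (`|r j - s j| <= dist_sup r s)%E.
Proof. by apply: ereal_sup_ubound; exists j. Qed.

(** The right-hand side is +oo as soon as a risk or the relative entropy is infinite;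
    otherwise this is [gibbs_excess_risk_le] with eps the largest deviation. *)
Lemma gibbs_mean_risk_le rhat lambda u a (risk : 'I_d -> \bar R) :
    0 < lambda -> simplex u -> simplex a ->
  (mean (gibbs u rhat lambda) risk - mean a risk <=
    (2 * lambda)^-1%:E * dist_sup (fun j => (rhat j)%:E) risk ^+ 2
    + lambda%:E * DKL a u)%E.
Proof.
move=> l0 us as_; set D := dist_sup _ _.
have l20 : 0 < (2 * lambda)^-1 by rewrite invr_gt0 mulr_gt0.
have [au|/DKL_not_dominated ->] := pselect (dominated a u); last first.
  rewrite gt0_muley ?lte_fin// addey ?leey//.
  by rewrite -ltNye (lt_le_trans ltNy0)// mule_ge0 ?sqre_ge0// lee_fin ltW.
rewrite DKL_dominated//.
have [/forallP riskfin|] := boolP [forall j, risk j \is a fin_num]; last first.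
  rewrite negb_forall => /existsP[j riskj].
  suff -> : D = +oo%E by rewrite expe2 mulyy gt0_muley ?lte_fin// addye// leey.
  apply/eqP; rewrite -leye_eq; apply: le_trans (dist_sup_ge _ _ j).
  by move: riskj; case: (risk j).
have riskE : risk = fun j => (fine (risk j))%:E.
  by apply/funext => j; rewrite fineK.
have D_fin : D \is a fin_num.
  rewrite fin_numElt; apply/andP; split.
    pose j := Ordinal (simplex_dim_gt0 us).
    by apply: lt_le_trans (dist_sup_ge _ _ j); rewrite (lt_le_trans ltNy0).
  apply: (@le_lt_trans _ _ (\sum_j `|(rhat j)%:E - risk j|)%E).
    apply: ge_ereal_sup => _ [j _ <-]; rewrite (bigD1 j)//= leeDl// sume_ge0//.
  by apply/lte_sum_pinfty => j _; rewrite riskE -EFinB abse_EFin ltry.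
rewrite riskE !mean_fin -EFinB -(fineK D_fin) -EFin_expe -!EFinM -EFinD lee_fin.
rewrite [X in _ <= X + _]mulrC.
apply: gibbs_excess_risk_le => // j.
by rewrite -lee_fin (fineK D_fin) -abse_EFin EFinB fineK// dist_sup_ge.
Qed.

Lemma continuous_fmean r : continuous (fmean r : 'rV[R]_d -> R).
Proof.
apply: continuous_big => [|j _]; first exact: add_continuous.
have cj : continuous (fun a : 'rV[R]_d => a 0 j) by exact: coord_continuous.
by move=> a; apply: cvgM; [exact: nbhs_filter|exact: cj|apply: cvg_cst; exact: nbhs_filter].
Qed.

(** Donsker-Varadhan duality, which shows that the ball is closed.  For the inclusion
    from right to left, a test function supported on a null coordinate of u forces
    domination, and h = ln (a / u), set to ln e on the null coordinates of a,
    recovers rKL a u up to e. *)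
Lemma KL_ball_dual u b : simplex u ->
  KL_ball u b = simplex `&` \bigcap_(h in [set: 'I_d -> R])
    [set a | fmean h a <= b + ln (norm1 (tilt u h))].
Proof.
move=> us; apply/seteqP; split=> a /= [as_ ab]; split=> //.
  have au : dominated a u.
    by apply: contrapT => /DKL_not_dominated aoo; move: ab; rewrite aoo.
  move=> h _ /=; move: ab; rewrite DKL_dominated// lee_fin.
  have := gibbs_variational h us as_ au.
  suff : 0 <= rKL a (softmax u h) by lra.
  apply: rKL_ge0 => //; first exact: simplex_softmax.
  by rewrite softmaxE//; exact: dominated_tilt.
have au : dominated a u.
  move=> j uj0; apply: contrapT => /eqP aj0.
  have ajp : 0 < a 0 j by rewrite lt_neqAle eq_sym aj0 as_.1.
  (* This h does not change u, and fmean h a = b + 1 exceeds the dual bound b. *)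
  pose h i : R := if i == j then (b + 1) / a 0 j else 0.
  have := ab h I; rewrite /=.
  have -> : tilt u h = u.
    apply/rowP => i; rewrite mxE /h; case: eqP => [->|_].
      by rewrite uj0 mul0r.
    by rewrite expR0 mulr1.
  have -> : norm1 u = 1.
    by rewrite -us.2; apply: eq_bigr => i _; rewrite ger0_norm// us.1.
  rewrite ln1 /fmean (bigD1 j)//= big1 => [|i ij].
    by rewrite /h eqxx mulrCA divff// mulr1; lra.
  by rewrite /h (negPf ij) mulr0.
rewrite DKL_dominated// lee_fin; apply/ler_addgt0Pr => e e0.
pose h i : R := if a 0 i == 0 then ln e else ln (a 0 i / u 0 i).
have -> : rKL a u = fmean h a.
  apply: eq_bigr => i _; rewrite /h; case: eqP => [->|//].
  by rewrite !mul0r.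
apply: le_trans (ab h I) _; rewrite lerD2l.
have Z_le : norm1 (tilt u h) <= 1 + e.
  rewrite norm1_tilt// -as_.2 -[e]mul1r -us.2 mulr_suml -big_split/=.
  apply: ler_sum => i _; rewrite mxE /h; case: eqP => [->|/eqP ai0].
    by rewrite add0r lnK.
  have aip : 0 < a 0 i by rewrite lt_neqAle eq_sym ai0 as_.1.
  have uip : 0 < u 0 i.
    by rewrite lt_neqAle us.1 andbT; apply: contra_neq ai0 => /esym/au.
  rewrite lnK ?posrE ?divr_gt0// mulrCA divff ?gt_eqF// mulr1.
  by rewrite lerDl mulr_ge0// ltW.
apply: (@le_trans _ _ (ln (1 + e))).
  by rewrite ler_ln// ?posrE ?norm1_tilt_gt0//; lra.
by apply: le_ln1Dx; lra.
Qed.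

Lemma compact_KL_ball u b : simplex u -> compact (KL_ball u b).
Proof.
move=> us.
apply: (@subclosed_compact _ _ [set a : 'rV[R]_d | forall j, `[0, 1]%classic (a ord0 j)]).
- rewrite KL_ball_dual//; apply: closedI.
    have -> : simplex = \bigcap_(j in [set: 'I_d]) [set a : 'rV[R]_d | 0 <= a 0 j]
        `&` [set a | fmean (fun=> 1) a = 1] :> set 'rV[R]_d.
      apply/seteqP; split=> a /=.
        move=> as_; split; first by move=> j _; exact: as_.1.
        exact: fmean_cst.
      move=> [a0]; rewrite /fmean => a1; split; first by move=> j; exact: a0.
      by rewrite -a1; apply: eq_bigr => j _; rewrite mulr1.
    apply: closedI.
      apply: closed_bigI => j _.
      apply: (closed_comp (f := fun a : 'rV[R]_d => a 0 j) (D := [set x | 0 <= x])).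
        by move=> a _; exact: coord_continuous.
      exact: closed_ge.
    apply: (closed_comp (f := fmean (fun=> 1)) (D := [set 1])).
      by move=> a _; exact: continuous_fmean.
    exact: closed_eq.
  apply: closed_bigI => h _.
  apply: (closed_comp (f := fmean h) (D := [set x | x <= b + ln (norm1 (tilt u h))])).
    by move=> a _; exact: continuous_fmean.
  exact: closed_le.
- by apply: (@rV_compact R d (fun=> `[0, 1]%classic)) => j; exact: segment_compact.
- move=> a [as_ _] j /=; rewrite in_itv/= as_.1/= -as_.2 (bigD1 j)//= lerDl.
  by apply: sumr_ge0 => i _; exact: as_.1.
Qed.

Lemma argmin_KL_ball r u b : simplex u -> 0 <= b -> exists a,
  is_argmin (KL_ball u b) (fun theta => mean theta (fun j => (r j)%:E)) a.
Proof.
move=> us b0.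
have ub : KL_ball u b u by split=> //; rewrite DKL_dominated// lee_fin rKLxx.
have [] := @EVT_min_rV R d (fmean r) (KL_ball u b).
- by exists u.
- exact: compact_KL_ball.
- by apply: continuous_subspaceT; exact: continuous_fmean.
move=> a /set_mem aball amin; exists a; split=> // y yball.
by rewrite !mean_fin lee_fin; apply: amin; exact/mem_set.
Qed.

End GibbsPosterior.

(** * Independence and Hoeffding's inequality *)

Section Independence.
Context {R : realType} {dP dS : measure_display}.
Context {Omega : measurableType dP} {S : measurableType dS}.
Context (P : probability Omega R).

Import HBNNSimple.

(** The hypothesis says that the law of Z under the density W is c times its law under
    P; monotone approximation by simple functions carries the equality of these
    measures over to integrals. *)
Lemma integral_weighted (W : Omega -> R) (Z : {RV P >-> S}) (c : \bar R) :
    measurable_fun [set: Omega] W -> (forall w, 0 <= W w) -> c \is a fin_num ->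
    (forall A, measurable A ->
      \int[P]_w (W w * \1_A (Z w))%:E = c * P (Z @^-1` A))%E ->
  forall g : S -> R, measurable_fun [set: S] g -> (forall s, 0 <= g s) ->
    (\int[P]_w (W w * g (Z w))%:E = c * \int[P]_w (g (Z w))%:E)%E.
Proof.
move=> mW W0 cfin WA g mg g0.
have mZ : measurable_fun [set: Omega] Z by [].
have mgE : measurable_fun [set: S] (fun s => (g s)%:E) by exact/measurable_EFinP.
pose h := nnsfun_approx measurableT mgE.
have hg x : (h n (Z x))%:E @[n --> \oo] --> (g (Z x))%:E.
  apply: (@cvg_nnsfun_approx _ _ _ _ measurableT _ mgE) => //.
  by move=> s _; rewrite /= lee_fin.
have mhZ n : measurable_fun [set: Omega] (fun x => h n (Z x)).
  by apply: measurableT_comp.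
have ndh s : {homo (fun n => h n s) : n m / (n <= m)%N >-> n <= m}.
  by move=> n m nm; exact/lefP/nd_nnsfun_approx.
have -> : (\int[P]_w (W w * g (Z w))%:E =
    limn (fun n => \int[P]_w (W w * h n (Z w))%:E))%E.
  rewrite -monotone_convergence//.
  - apply: eq_integral => x _; apply/esym/cvg_lim => //.
    under eq_fun do rewrite EFinM; rewrite EFinM.
    by apply: cvgeZl => //; exact: hg.
  - by move=> n; apply/measurable_EFinP; apply: measurable_funM.
  - by move=> n x _; rewrite lee_fin mulr_ge0.
  - by move=> x _ n m nm; rewrite lee_fin ler_wpM2l// ndh.
have -> : (\int[P]_w (g (Z w))%:E = limn (fun n => \int[P]_w (h n (Z w))%:E))%E.
  rewrite -monotone_convergence//.
  - by apply: eq_integral => x _; apply/esym/cvg_lim => //; exact: hg.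
  - by move=> n; apply/measurable_EFinP.
  - by move=> n x _; rewrite lee_fin.
  - by move=> x _ n m nm; rewrite lee_fin ndh.
rewrite -limeMl//; last first.
  apply: ereal_nondecreasing_is_cvgn => n m nm; apply: ge0_le_integral => //.
  - by move=> x _; rewrite lee_fin.
  - by apply/measurable_EFinP.
  - by apply/measurable_EFinP.
  - by move=> x _; rewrite lee_fin ndh.
congr (limn _); apply/funext => n.
have hE x : h n (Z x) = \sum_(y \in range (h n)) y * \1_(h n @^-1` [set y]) (Z x).
  by rewrite fimfunE.
have mZy y : measurable_fun [set: Omega] (fun x => \1_(h n @^-1` [set y]) (Z x) : R).
  by apply: measurableT_comp.
have y0 y x : 0 <= y * \1_(h n @^-1` [set y]) x :> R.
  by rewrite -lee_fin; exact: nnfun_muleindic_ge0.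
have ind_ge0 y x : 0 <= \1_(h n @^-1` [set y]) x :> R by rewrite indicE.
have my y : measurable (h n @^-1` [set y]) by exact: measurable_funPTI.
have fr : finite_set (range (h n)) by exact: fimfunP.
transitivity (\int[P]_w (\sum_(y \in range (h n))
    (y * (W w * \1_(h n @^-1` [set y]) (Z w)))%:E)%E)%E.
  apply: eq_integral => x _; rewrite fsumEFin// hE !fsbig_finite//= mulr_sumr; congr EFin.
  by apply: eq_bigr => y _; ring.
rewrite ge0_integral_fsum//; last 2 first.
- by move=> y; apply/measurable_EFinP; do 2 apply: measurable_funM => //.
- by move=> y x _; rewrite lee_fin mulrCA mulr_ge0.
transitivity (\sum_(y \in range (h n)) c * \int[P]_w (y * \1_(h n @^-1` [set y]) (Z w))%:E)%E.
  apply: eq_fsbigr => y /set_mem[x _ hxy]; have yge0 : 0 <= y by rewrite -hxy.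
  under eq_integral do rewrite EFinM.
  rewrite ge0_integralZl_EFin//; last 2 first.
  - by move=> w _; rewrite lee_fin mulr_ge0.
  - by apply/measurable_EFinP; apply: measurable_funM.
  rewrite WA//; under [in RHS]eq_integral do rewrite EFinM.
  rewrite ge0_integralZl_EFin//; last by apply/measurable_EFinP.
  rewrite muleCA; congr (_ * (_ * _))%E.
  by rewrite -[Z @^-1` _]setIT -integral_indic//; exact: measurable_funPTI.
rewrite -ge0_mule_fsumr; last by move=> y; apply: integral_ge0 => w _; rewrite lee_fin.
congr (_ * _)%E; rewrite -ge0_integral_fsum//.
- by apply: eq_integral => x _; rewrite hE fsumEFin.
- by move=> y; apply/measurable_EFinP; apply: measurable_funM.
- by move=> y x _; rewrite lee_fin.
Qed.

(** The product rule is given for indicators.  They are replaced by the functions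
    F i one index at a time: at each step [integral_weighted] applies to Z k with the
    product of all the other factors as weight. *)
Lemma integral_prod_independent (n : nat) (Z : 'I_n -> {RV P >-> S})
    (F : 'I_n -> S -> R) : independent_RVs Z ->
    (forall i, measurable_fun [set: S] (F i)) -> (forall i s, 0 <= F i s) ->
    (forall i, \int[P]_w (F i (Z i w))%:E < +oo)%E ->
  (\int[P]_w (\prod_i F i (Z i w))%:E = \prod_i \int[P]_w (F i (Z i w))%:E)%E.
Proof.
move=> indep.
(* s lists the indices whose factor has already been replaced. *)
suff claim (s : seq 'I_n) : uniq s -> forall (G : 'I_n -> S -> R)
    (A : 'I_n -> set S), (forall i, measurable (A i)) ->
    (forall i, measurable_fun [set: S] (G i)) -> (forall i s, 0 <= G i s) ->
    (forall i, \int[P]_w (G i (Z i w))%:E < +oo)%E ->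
    (forall i, i \notin s -> G i = \1_(A i)) ->
    (\int[P]_w (\prod_i G i (Z i w))%:E = \prod_i \int[P]_w (G i (Z i w))%:E)%E.
  move=> mF F0 Foo; apply: (claim (index_enum 'I_n) _ F (fun=> set0)) => //.
    exact: index_enum_uniq.
  by move=> i; rewrite mem_index_enum.
elim: s => [_ G A mA _ _ _ GA|k s IH /= /andP[ks us] G A mA mG G0 Goo GA].
  have mZA i : measurable (Z i @^-1` A i) by exact: measurable_funPTI.
  have -> : (\prod_i \int[P]_w (G i (Z i w))%:E = \prod_i P (Z i @^-1` A i))%E.
    apply: eq_bigr => i _; rewrite GA// -[Z i @^-1` A i]setIT -integral_indic//.
  have := indep [set: 'I_n]%SET A mA; rewrite (eq_bigl xpredT) => [<-|i]; last by rewrite inE.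
  rewrite -[X in P X]setIT -integral_indic//; last first.
    by apply: fin_bigcap_measurable => // i _; exact: mZA.
  apply: eq_integral => w _; congr EFin; under eq_bigr do rewrite GA//.
  have [wA|wA] := boolP [forall i, Z i w \in A i].
    rewrite indicE mem_set => [|i _]; last exact/set_mem/(forallP wA).
    by apply: big1 => i _; rewrite indicE (forallP wA).
  move: wA; rewrite negb_forall => /existsP[i wAi].
  rewrite (bigD1 i)//= !indicE (negPf wAi) mul0r memNset// => /(_ i).
  by rewrite /= inE => /(_ isT) /mem_set; rewrite (negPf wAi).
pose W w := \prod_(i | i != k) G i (Z i w).
have mGZ i : measurable_fun [set: Omega] (fun w => G i (Z i w)).
  by apply: measurableT_comp.
transitivity (\int[P]_w (W w * G k (Z k w))%:E)%E.
  by apply: eq_integral => w _; rewrite (bigD1 k)//= mulrC.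
rewrite (bigD1 k)//= muleC.
apply: integral_weighted => //.
- rewrite (_ : W = fun w => \prod_(i <- [seq i <- index_enum 'I_n | i != k]) G i (Z i w)).
    by apply: measurable_prod => i _; exact: mGZ.
  by apply/funext => w; rewrite big_filter.
- by move=> w; apply: prodr_ge0.
- apply: (big_ind (fun x => x \is a fin_num)) => // [x y|i _].
    exact: fin_numM.
  by rewrite ge0_fin_numE//; apply: integral_ge0 => w _; rewrite lee_fin.
move=> B mB.
pose G' i := if i == k then \1_B else G i.
have := IH us G' (fun i => if i == k then B else A i).
have -> : (\int[P]_w (\prod_i G' i (Z i w))%:E =
    \int[P]_w (W w * \1_B (Z k w))%:E)%E.
  apply: eq_integral => w _; rewrite (bigD1 k)//= mulrC /G' eqxx; congr (_ * _)%:E.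
  by apply: eq_bigr => i /negPf ->.
have intB : (\int[P]_w (\1_B (Z k w))%:E = P (Z k @^-1` B))%E.
  by rewrite -[Z k @^-1` B]setIT -integral_indic//; exact: measurable_funPTI.
rewrite (bigD1 k)//= muleC /G' eqxx intB; under eq_bigr => i /negPf ik do rewrite ik.
apply.
- by move=> i; case: ifP.
- by move=> i; case: ifP.
- by move=> i s'; case: ifP => // _; rewrite indicE.
- move=> i; case: eqP => // ->; rewrite intB.
  by apply: le_lt_trans (probability_le1 _ _) (ltry _); exact: measurable_funPTI.
- by move=> i is_; case: eqP => // /eqP ik; apply: GA; rewrite inE negb_or ik.
Qed.

Lemma integrable_bounded_RV (X : Omega -> R) (a b : R) :
    measurable_fun [set: Omega] X -> (forall w, a <= X w <= b) ->
  P.-integrable [set: Omega] (EFin \o X).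
Proof.
move=> mX Xab; apply: measurable_bounded_integrable => //.
  exact: le_lt_trans (probability_le1 P measurableT) (ltry 1).
exists (`|a| + `|b|); split; first exact: num_real.
move=> M ltM w _; apply: le_trans (ltW ltM).
by have /andP[aX Xb] := Xab w; rewrite ler_norml; apply/andP; split;
  [have := ler_norm (- a); rewrite normrN|have := ler_norm b];
  have := normr_ge0 a; have := normr_ge0 b; lra.
Qed.

Lemma hoeffding_mgf (X : Omega -> R) (a b m t : R) :
    measurable_fun [set: Omega] X -> (forall w, a <= X w <= b) ->
    (\int[P]_w (X w)%:E = m%:E)%E ->
  (\int[P]_w (expR (t * (X w - m)))%:E <=
    (expR (t ^+ 2 * (b - a) ^+ 2 / 8))%:E)%E.
Proof.
move=> mX Xab EX; set s := t ^+ 2 * _ / _.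
have intX := integrable_bounded_RV mX Xab.
have intc (c : R) : P.-integrable [set: Omega] (EFin \o cst c).
  exact: finite_measure_integrable_cst.
have cstE (c : R) : (\int[P]__ c%:E = c%:E)%E.
  by rewrite -[RHS]mule1 -(probability_setT P) -integral_cst.
have mab : a <= m <= b.
  apply/andP; split; rewrite -lee_fin -EX.
    rewrite -[leLHS]cstE; apply: le_integral => //; first exact: intc.
    by move=> w _; rewrite lee_fin; have /andP[] := Xab w.
  rewrite -[leRHS]cstE; apply: le_integral => //; first exact: intc.
  by move=> w _; rewrite lee_fin; have /andP[] := Xab w.
have [beta betaP] := hoeffding_chord t mab; rewrite -/s in betaP.
apply: (@le_trans _ _ (\int[P]_w (expR s - beta * m + beta * X w)%:E)%E).
  apply: ge0_le_integral => //.
  - apply/measurable_EFinP; apply: measurableT_comp => //.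
    by apply: measurable_funM => //; apply: measurable_funB.
  - apply/measurable_EFinP; apply: measurable_funD => //.
    exact: measurable_funM.
  - by move=> w _; rewrite lee_fin; have := betaP _ (Xab w); lra.
under eq_integral do rewrite EFinD EFinM.
rewrite integralD//=; [|exact: intc|exact: integrableZl].
rewrite integralZl// EX cstE.
by rewrite -EFinM -EFinD lee_fin subrK.
Qed.

(** Chernoff's bound at t = 4 s / (b - a)^2, which minimises
    - t n s + n t^2 (b - a)^2 / 8. *)
Lemma hoeffding_upper (n : nat) (Z : 'I_n -> {RV P >-> S}) (f : S -> R)
    (a b m s : R) : (0 < n)%N -> a < b -> 0 < s -> independent_RVs Z ->
    measurable_fun [set: S] f -> (forall x, a <= f x <= b) ->
    (forall i, \int[P]_w (f (Z i w))%:E = m%:E)%E ->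
  (P [set w | (s <= n%:R^-1 * \sum_i f (Z i w) - m)%R] <=
    (expR (- (2 * n%:R * s ^+ 2 / (b - a) ^+ 2)))%:E)%E.
Proof.
move=> n0 ab s0 indep mf fab Ef.
have ba0 : 0 < b - a by rewrite subr_gt0.
have nR0 : 0 < n%:R :> R by rewrite ltr0n.
pose t : R := 4 * s / (b - a) ^+ 2.
have t0 : 0 < t by rewrite divr_gt0 ?mulr_gt0 ?exprn_gt0.
pose X w : R := \sum_i (f (Z i w) - m).
have mfZ i : measurable_fun [set: Omega] (fun w => f (Z i w)).
  by apply: measurableT_comp.
have mX : measurable_fun [set: Omega] X.
  by apply: measurable_sum => i; exact: measurable_funB.
have -> : [set w | s <= n%:R^-1 * \sum_i f (Z i w) - m] =
    [set w | X w >= n%:R * s].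
  have XE w : X w = n%:R * (n%:R^-1 * \sum_i f (Z i w) - m).
    rewrite mulrBr mulrA divff ?gt_eqF// mul1r /X sumrB sumr_const card_ord.
    by rewrite mulr_natl.
  by apply: eq_set => w; rewrite XE ler_pM2l.
have := chernoff (mfun_Sub (mem_set mX) : {RV P >-> R}) (n%:R * s) t0.
move=> /le_trans; apply.
have -> : (mmt_gen_fun P X t = \prod_i \int[P]_w (expR (t * (f (Z i w) - m)))%:E)%E.
  rewrite /mmt_gen_fun unlock -(integral_prod_independent (F := fun _ x => expR (t * (f x - m))))//.
  - by apply: eq_integral => w _; rewrite /= /X mulr_suml expR_sum; congr EFin;
      apply: eq_bigr => i _; rewrite mulrC.
  - move=> i; apply: measurableT_comp => //; apply: measurable_funM => //.
    exact: measurable_funB.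
  - move=> i; apply: le_lt_trans (ltry _).
    exact: (hoeffding_mgf _ (mfZ i) (fun w => fab _) (Ef i)).
apply: (@le_trans _ _ ((expR (t ^+ 2 * (b - a) ^+ 2 / 8) ^+ n)%:E *
    (expR (- (t * (n%:R * s))))%:E)%E).
  rewrite lee_pmul2r ?lte_fin ?expR_gt0//.
  rewrite -[n in leRHS]card_ord -prodr_const -prodEFin.
  apply: (proj2 (andP _)); apply: (big_ind2 (fun x y : \bar R => (0 <= x <= y)%E)).
  - by rewrite lee_fin ler01 lexx.
  - move=> x1 x2 y1 y2 /andP[x10 x12] /andP[y10 y12].
    by rewrite mule_ge0//= lee_pmul.
  move=> i _; apply/andP; split.
    by apply: integral_ge0 => w _; rewrite lee_fin expR_ge0.
  exact: (hoeffding_mgf _ (mfZ i) (fun w => fab _) (Ef i)).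
rewrite -EFinM lee_fin -expRM_natl -expRD ler_expR le_eqVlt; apply/orP; left.
by apply/eqP; rewrite /t; field; rewrite gt_eqF.
Qed.

End Independence.

(** * Uniform deviation of the training risks *)

Section UniformDeviation.
Context {R : realType} {dP dS : measure_display}.
Context {Omega : measurableType dP} {S : measurableType dS}.
Context (P : probability Omega R).

(** Union bound over the 2 d tails; s is chosen to give each of them probability at
    most exp (- delta) / (2 d). *)
Lemma uniform_hoeffding (d n : nat) (Z : 'I_n -> {RV P >-> S})
    (f : 'I_d -> S -> R) (m : 'I_d -> R) (C delta s : R) :
    (0 < n)%N -> (0 < d)%N -> 0 < C -> 0 < s ->
    s ^+ 2 = C ^+ 2 * (ln (2 * d%:R) + delta) / (2 * n%:R) ->
    independent_RVs Z -> (forall j, measurable_fun [set: S] (f j)) ->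
    (forall j x, 0 <= f j x <= C) ->
    (forall i j, \int[P]_w (f j (Z i w))%:E = (m j)%:E)%E ->
  exists G : set Omega, [/\ measurable G, ((1 - expR (- delta))%:E <= P G)%E &
    forall w, G w -> forall j, `|n%:R^-1 * \sum_i f j (Z i w) - m j| <= s].
Proof.
move=> n0 d0 C0 s0 sE indep mf f0C Ef.
have nR0 : 0 < n%:R :> R by rewrite ltr0n.
have dR0 : 0 < d%:R :> R by rewrite ltr0n.
have mfZ i j : measurable_fun [set: Omega] (fun w => f j (Z i w)).
  by apply: measurableT_comp.
pose up j := [set w | s <= n%:R^-1 * \sum_i f j (Z i w) - m j].
pose lo j := [set w | s <= n%:R^-1 * \sum_i - f j (Z i w) - - m j].
have mlt (X : Omega -> R) (c : R) : measurable_fun [set: Omega] X ->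
    measurable [set w | s <= n%:R^-1 * X w - c].
  move=> mX; rewrite -[X in measurable X]setTI; apply: measurable_fun_le => //.
  by apply: measurable_funB => //; exact: measurable_funM.
have mup j : measurable (up j) by apply: mlt; exact: measurable_sum.
have mlo j : measurable (lo j).
  by apply: mlt; apply: measurable_sum => i; exact: measurableT_comp.
have tailE : expR (- (2 * n%:R * s ^+ 2 / (C - 0) ^+ 2))
    = expR (- delta) / (2 * d%:R).
  rewrite sE subr0 -[2 * d%:R in RHS]lnK ?posrE ?mulr_gt0// -expRB.
  by congr expR; field; rewrite !gt_eqF.
have Pup j : (P (up j) <= (expR (- delta) / (2 * d%:R))%:E)%E.
  by rewrite -tailE; apply: hoeffding_upper.
have Plo j : (P (lo j) <= (expR (- delta) / (2 * d%:R))%:E)%E.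
  rewrite -tailE; have -> : C - 0 = 0 - - C by ring.
  apply: (hoeffding_upper (f := fun x => - f j x) (m := - m j)) => //.
  - by rewrite oppr_lt0.
  - exact: measurableT_comp.
  - by move=> x; have /andP[] := f0C j x; lra.
  move=> i; under eq_integral do rewrite EFinN.
  rewrite integral_ge0N ?Ef// => w _.
  by rewrite lee_fin; have /andP[] := f0C j (Z i w).
pose U := \bigcup_j (up j `|` lo j).
have mU : measurable U by apply: fin_bigcup_measurable => // j _; exact: measurableU.
have PU : (P U <= (expR (- delta))%:E)%E.
  apply: (@le_trans _ _ (\sum_(j \in [set` index_enum 'I_d]) P (up j `|` lo j))%E).
    apply: content_sub_fsum => //.
      by move=> j _; exact: measurableU.
    by move=> w [j _ Aj]; exists j => //=; exact: mem_index_enum.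
  rewrite -fsbig_seq ?index_enum_uniq//.
  apply: (@le_trans _ _ (\sum_(j < d) (2 * (expR (- delta) / (2 * d%:R)))%:E)%E).
    apply: lee_sum => j _; apply: le_trans (measureU2 P (mup j) (mlo j)) _.
    by rewrite mulr_natl mulr2n EFinD; apply: leeD; [exact: Pup|exact: Plo].
  rewrite sumEFin lee_fin sumr_const card_ord -mulr_natl le_eqVlt; apply/orP; left.
  by apply/eqP; field; rewrite gt_eqF.
exists (~` U); split.
- exact: measurableC.
- by rewrite probability_setC// EFinB; apply: leeB.
move=> w Uw j; rewrite leNgt; apply/negP => lt_s; apply: Uw; exists j => //.
move: lt_s; rewrite ltr_normr => /orP[] lt_s; [left|right]; rewrite /up/lo/=.
  exact: ltW.
by rewrite sumrN mulrN -opprD ltW.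
Qed.

End UniformDeviation.

(** * Excess risk with high probability *)

Section RiskBound.
Context {R : realType} {d n : nat}.

Lemma measurable_mean_softmax {dP : measure_display} {Omega : measurableType dP}
    (u : 'rV[R]_d) (m : 'I_d -> R) (h : Omega -> 'I_d -> R) : simplex u ->
    (forall j, measurable_fun [set: Omega] (fun w => h w j)) ->
  measurable_fun [set: Omega] (fun w => fmean m (softmax u (h w))).
Proof.
move=> us mh; apply: measurable_sum => j; apply: measurable_funM => //.
under eq_fun do rewrite softmaxE// mxE.
apply: measurable_funM => //; apply: measurableT_comp => //.
apply: measurable_funB => //; apply: measurableT_comp => //.
apply: measurable_sum => i; apply: measurableT_comp => //.
under eq_fun do rewrite mxE.
by apply: measurable_funM => //; exact: measurableT_comp.
Qed.

Definition sample_loss (ell : R -> R -> R) (j : 'I_d) (x : d.-tuple R * R) : R :=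
  ell (tnth x.1 j) x.2.

Lemma measurable_sample_loss ell j :
  measurable_fun [set: R * R] (fun p => ell p.1 p.2) ->
  measurable_fun [set: d.-tuple R * R] (sample_loss ell j).
Proof.
move=> mell.
apply: (measurableT_comp (f := fun p : R * R => ell p.1 p.2)
  (g := fun x : d.-tuple R * R => (tnth x.1 j, x.2))) => //.
apply: measurable_fun_pair => /=.
  exact: (measurableT_comp (measurable_tnth j) measurable_fst).
exact: measurable_snd.
Qed.

Lemma avg_loss_sample ell (z : 'I_n -> d.-tuple R * R) j :
  avg_loss ell (predictors z j) (response z)
  = n%:R^-1 * \sum_i sample_loss ell j (z i).
Proof. by congr (_ * _); apply: eq_bigr => i _; rewrite !mxE. Qed.

Lemma same_law_integral {dP dQ dS : measure_display}
    {OmegaP : measurableType dP} {OmegaQ : measurableType dQ}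
    {S : measurableType dS} (P : probability OmegaP R) (Q : probability OmegaQ R)
    (X : {RV P >-> S}) (Y : {RV Q >-> S}) (f : S -> R) : same_law X Y ->
    measurable_fun [set: S] f -> (forall x, 0 <= f x) ->
  (\int[P]_w (f (X w))%:E = \int[Q]_w (f (Y w))%:E)%E.
Proof.
move=> XY mf f0.
have mfE : measurable_fun [set: S] (fun x => (f x)%:E) by exact/measurable_EFinP.
have := ge0_integral_distribution X mfE; rewrite /comp => <-; last first.
  by move=> x; rewrite lee_fin.
have := ge0_integral_distribution Y mfE; rewrite /comp => <-; last first.
  by move=> x; rewrite lee_fin.
by apply: eq_measure_integral => A mA _; exact: XY.
Qed.

Lemma test_risk_iid {dP dQ : measure_display}
    {OmegaP : measurableType dP} {OmegaQ : measurableType dQ}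
    (P : probability OmegaP R) (Q : probability OmegaQ R)
    (Z : 'I_n -> {RV P >-> (d.-tuple R * R)%type})
    (Zs : 'I_n -> {RV Q >-> (d.-tuple R * R)%type})
    (ell : R -> R -> R) (C : R) : (0 < n)%N ->
    measurable_fun [set: R * R] (fun p => ell p.1 p.2) ->
    (forall x y, 0 <= ell x y <= C) ->
    (forall i k, same_law (Zs i) (Z k)) ->
  exists m : 'I_d -> R, (test_risk ell Zs = fun j => (m j)%:E) /\
    forall i j, (\int[P]_w (sample_loss ell j (Z i w))%:E = (m j)%:E)%E.
Proof.
move=> n0 mell ell0C ZsZ; pose i0 := Ordinal n0.
have mf j := measurable_sample_loss j mell.
have f0 j x : 0 <= sample_loss ell j x by have /andP[] := ell0C (tnth x.1 j) x.2.
have mfZs i j : measurable_fun [set: OmegaQ] (fun w => sample_loss ell j (Zs i w)).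
  by apply: measurableT_comp.
have intZs i j : Q.-integrable [set: OmegaQ]
    (EFin \o (fun w => sample_loss ell j (Zs i w))).
  by apply: (integrable_bounded_RV Q (mfZs i j) (a := 0) (b := C)) => w; exact: ell0C.
pose m j := fine (\int[Q]_w (sample_loss ell j (Zs i0 w))%:E).
have mE i j : (\int[P]_w (sample_loss ell j (Z i w))%:E = (m j)%:E)%E.
  rewrite -(same_law_integral (ZsZ i0 i)) // fineK//.
  exact: integrable_fin_num (intZs _ _).
have mE' i j : (\int[Q]_w (sample_loss ell j (Zs i w))%:E = (m j)%:E)%E.
  by rewrite (same_law_integral (ZsZ i i0)).
exists m; split=> //; apply/funext => j.
rewrite /test_risk unlock.
under eq_integral do rewrite avg_loss_sample EFinM -sumEFin.
rewrite ge0_integralZl_EFin//; last 2 first.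
- by move=> w _; apply: sume_ge0 => i _; rewrite lee_fin.
- by apply: emeasurable_sum => i; exact/measurable_EFinP.
rewrite ge0_integral_sum//; last 2 first.
- by move=> i; exact/measurable_EFinP.
- by move=> i w _; rewrite lee_fin.
under eq_bigr do rewrite mE'.
rewrite sumEFin -EFinM sumr_const card_ord -[m j *+ n]mulr_natl mulrA mulVf ?mul1r//.
by rewrite pnatr_eq0 -lt0n.
Qed.

(** On the event of [uniform_hoeffding] the deterministic bound holds with eps = s,
    and s^2 / (2 lambda) is the first term of the claim. *)
Lemma gibbs_risk_whp {dP : measure_display} {Omega : measurableType dP}
    (P : probability Omega R) (Z : 'I_n -> {RV P >-> (d.-tuple R * R)%type})
    (ell : R -> R -> R) (m : 'I_d -> R) (u a : 'rV[R]_d) (C b delta lambda : R) :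
    (0 < n)%N -> measurable_fun [set: R * R] (fun p => ell p.1 p.2) ->
    0 < C -> (forall x y, 0 <= ell x y <= C) -> independent_RVs Z ->
    (forall i j, (\int[P]_w (sample_loss ell j (Z i w))%:E = (m j)%:E)%E) ->
    simplex u -> KL_ball u b a -> 0 < delta -> 0 < lambda ->
  with_prob_at_least P (1 - expR (- delta))
    [set w | (mean (gibbs u (train_risk ell (predictors (fun i => Z i w))
                       (response (fun i => Z i w))) lambda) (fun j => (m j)%:E)
       - mean a (fun j => (m j)%:E)
     <= (C ^+ 2 * (ln (2 * d%:R) + delta) / (4 * n%:R * lambda)
         + lambda * b)%:E)%E].
Proof.
move=> n0 mell C0 ell0C indep mE us [as_ ab] delta0 l0.
pose rhat w : 'I_d -> R := train_risk ell (predictors (fun i => Z i w))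
  (response (fun i => Z i w)).
have rhatE w j : rhat w j = n%:R^-1 * \sum_i sample_loss ell j (Z i w).
  exact: avg_loss_sample.
have mrhat j : measurable_fun [set: Omega] (fun w => rhat w j).
  under eq_fun do rewrite rhatE.
  apply: measurable_funM => //; apply: measurable_sum => i.
  by apply: measurableT_comp => //; exact: measurable_sample_loss.
pose bound := C ^+ 2 * (ln (2 * d%:R) + delta) / (4 * n%:R * lambda) + lambda * b.
rewrite (_ : [set w | _] =
    [set w | fmean m (gibbs u (rhat w) lambda) <= fmean m a + bound]); last first.
  by apply: eq_set => w; rewrite !mean_fin -EFinB lee_fin lerBlDl.
have mA : measurable
    [set w | fmean m (gibbs u (rhat w) lambda) <= fmean m a + bound].
  rewrite -[X in measurable X]setTI; apply: measurable_fun_le => //.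
  apply: measurable_mean_softmax => // j.
  exact: measurable_funM.
have d0 := simplex_dim_gt0 us.
have nR0 : 0 < n%:R :> R by rewrite ltr0n.
have L0 : 0 < ln (2 * d%:R) + delta.
  apply: ltr_wpDl => //; apply: ln_ge0.
  by rewrite -natrM ler1n muln_gt0.
pose s := C * Num.sqrt ((ln (2 * d%:R) + delta) / (2 * n%:R)).
have s0 : 0 < s by rewrite mulr_gt0// sqrtr_gt0 divr_gt0// mulr_gt0.
have sE : s ^+ 2 = C ^+ 2 * (ln (2 * d%:R) + delta) / (2 * n%:R).
  by rewrite exprMn sqr_sqrtr ?mulrA// ltW// divr_gt0// mulr_gt0.
have au : dominated a u.
  by apply: contrapT => /DKL_not_dominated aoo; move: ab; rewrite aoo.
have [G [mG PG Gs]] := uniform_hoeffding n0 d0 C0 s0 sE indep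
  (fun j => measurable_sample_loss j mell) (fun j x => ell0C _ _) mE.
split=> //; apply: le_trans PG _; apply: le_measure; rewrite ?inE//.
move=> w /Gs Gw /=; rewrite -lerBlDl.
apply: le_trans (gibbs_excess_risk_le l0 us as_ au (eps := s) _) _.
  by move=> j; rewrite rhatE.
rewrite /bound lerD//.
  by rewrite sE le_eqVlt; apply/orP; left; apply/eqP; field; rewrite !gt_eqF.
by rewrite ler_pM2l// -lee_fin -DKL_dominated.
Qed.

End RiskBound.

Theorem proposition6 (R : realType) (d n : nat) (n_gt0 : (0 < n)%N)
    (ell : R -> R -> R) (u : 'rV[R]_d) (u_simplex : simplex u)
    (dQ : measure_display) (OmegaQ : measurableType dQ)
    (Q : probability OmegaQ R)
    (Zs : 'I_n -> {RV Q >-> (d.-tuple R * R)%type}) :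
  let risk := test_risk ell Zs in
  (forall (X : 'I_d -> 'rV[R]_n) (Y : 'rV[R]_n) (lambda : R), 0 < lambda ->
    let rhat := train_risk ell X Y in
    (exists! that : 'rV[R]_d, gibbs_posterior rhat lambda u that) /\
    forall theta : 'rV[R]_d, simplex theta ->
    let bound := ((2 * lambda)^-1%:E * dist_sup (fun j => (rhat j)%:E) risk ^+ 2
                  + lambda%:E * DKL theta u)%E in
    (forall that : 'rV[R]_d, gibbs_posterior rhat lambda u that ->
      (mean that risk - mean theta risk <= bound)%E) /\
    (forall (eta : R) (T : nat), 0 < eta -> T%:R = 1 / (eta * lambda) ->
      (mean (egd eta (fmean rhat) u T) risk - mean theta risk <= bound)%E))
  /\
  (forall (dP : measure_display) (OmegaP : measurableType dP)
      (P : probability OmegaP R)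
      (Z : 'I_n -> {RV P >-> (d.-tuple R * R)%type}) (C : R),
    measurable_fun [set: R * R] (fun p => ell p.1 p.2) ->
    0 < C -> (forall x y, 0 <= ell x y <= C) ->
    iid Z -> (forall i k, same_law (Zs i) (Z k)) ->
    let rhat w := train_risk ell (predictors (fun i => Z i w))
                                 (response (fun i => Z i w)) in
    forall b : R, 0 < b ->
    exists thetab : 'rV[R]_d,
      is_argmin (KL_ball u b) (fun theta => mean theta risk) thetab /\
      forall delta : R, 0 < delta ->
      (forall lambda : R, 0 < lambda ->
        let bound := C ^+ 2 * (ln (2 * d%:R) + delta) / (4 * n%:R * lambda)
                     + lambda * b in
        (forall that : OmegaP -> 'rV[R]_d,
          (forall w, gibbs_posterior (rhat w) lambda u (that w)) ->
          with_prob_at_least P (1 - expR (- delta))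
            [set w | (mean (that w) risk - mean thetab risk <= bound%:E)%E]) /\
        (forall (eta : R) (T : nat), 0 < eta -> T%:R = 1 / (eta * lambda) ->
          with_prob_at_least P (1 - expR (- delta))
            [set w | (mean (egd eta (fmean (rhat w)) u T) risk
                      - mean thetab risk <= bound%:E)%E])) /\
      (let lambda :=
         C / 2 * Num.sqrt ((ln (2 * d%:R) + delta) / (b * n%:R)) in
       let bound := C * Num.sqrt (b * (ln (2 * d%:R) + delta) / n%:R) in
        (forall that : OmegaP -> 'rV[R]_d,
          (forall w, gibbs_posterior (rhat w) lambda u (that w)) ->
          with_prob_at_least P (1 - expR (- delta))
            [set w | (mean (that w) risk - mean thetab risk <= bound%:E)%E]) /\
        (forall (eta : R) (T : nat), 0 < eta -> T%:R = 1 / (eta * lambda) ->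
          with_prob_at_least P (1 - expR (- delta))
            [set w | (mean (egd eta (fmean (rhat w)) u T) risk
                      - mean thetab risk <= bound%:E)%E]))).
Proof.
move=> risk; split=> [X Y lambda l0 rhat|].
  split.
    exists (gibbs u rhat lambda); split; first exact/gibbs_posteriorP.
    by move=> q /gibbs_posteriorP ->.
  move=> theta thetas bound; split=> [q /gibbs_posteriorP -> //|eta T eta0 TE].
    exact: gibbs_mean_risk_le.
  by rewrite (egd_gibbs (lambda := lambda))//; exact: gibbs_mean_risk_le.
move=> dP OmegaP P Z C mell C0 ell0C [indep _] ZsZ rhat b b0.
have [m [riskE mE]] := test_risk_iid n_gt0 mell ell0C ZsZ.
have [a amin] := argmin_KL_ball m u_simplex (ltW b0).
exists a; rewrite /risk riskE; split=> // delta delta0.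
have gibbs_whp lambda := @gibbs_risk_whp R d n dP OmegaP P Z ell m u a C b delta
  lambda n_gt0 mell C0 ell0C indep mE u_simplex amin.1 delta0.
have whp lambda bound : 0 < lambda ->
    C ^+ 2 * (ln (2 * d%:R) + delta) / (4 * n%:R * lambda) + lambda * b = bound ->
    (forall that : OmegaP -> 'rV[R]_d,
      (forall w, gibbs_posterior (rhat w) lambda u (that w)) ->
      with_prob_at_least P (1 - expR (- delta))
        [set w | (mean (that w) (fun j => (m j)%:E)
                  - mean a (fun j => (m j)%:E) <= bound%:E)%E]) /\
    (forall (eta : R) (T : nat), 0 < eta -> T%:R = 1 / (eta * lambda) ->
      with_prob_at_least P (1 - expR (- delta))
        [set w | (mean (egd eta (fmean (rhat w)) u T) (fun j => (m j)%:E)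
                  - mean a (fun j => (m j)%:E) <= bound%:E)%E]).
  move=> l0 <-; split=> [that thatP|eta T eta0 TE].
    have -> : that = fun w => gibbs u (rhat w) lambda.
      by apply/funext => w; apply/gibbs_posteriorP.
    exact: gibbs_whp.
  under eq_set do rewrite (egd_gibbs (lambda := lambda))//.
  exact: gibbs_whp.
split; first by move=> lambda l0; exact: whp.
have nR0 : 0 < n%:R :> R by rewrite ltr0n.
have L0 : 0 < ln (2 * d%:R) + delta.
  apply: ltr_wpDl => //; apply: ln_ge0.
  by rewrite -natrM ler1n muln_gt0 (simplex_dim_gt0 u_simplex).
(* In terms of x both summands of the bound equal C b x / 2. *)
pose x := Num.sqrt ((ln (2 * d%:R) + delta) / (b * n%:R)).
have x0 : 0 < x by rewrite sqrtr_gt0 divr_gt0// mulr_gt0.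
have LE : ln (2 * d%:R) + delta = x ^+ 2 * (b * n%:R).
  by rewrite sqr_sqrtr ?divfK// ?gt_eqF ?mulr_gt0// ltW// divr_gt0// mulr_gt0.
apply: whp; first by rewrite mulr_gt0// divr_gt0.
rewrite -/x.
have -> : b * (ln (2 * d%:R) + delta) / n%:R = (b * x) ^+ 2.
  by rewrite LE; field; rewrite gt_eqF.
rewrite sqrtr_sqr gtr0_norm ?mulr_gt0// -/x LE; field.
by rewrite !gt_eqF.
Qed.
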